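(* Let $E^I_m(q;x,y)=\sum_{T\in\mathcal{T}^I_m}x^{l(T)}y^{u(T)}q^{\operatorname{inv}(T)}$ for $m\ge1$ and set $E^I_0(q;x,y)=x$. Then for all $n\ge1$, \[ E^I_{n+1}(q;x,y)=y\,E^I_n(q;x,y)+\sum_{k=0}^{n-2}q^{\,n-k-1}{n-1\brack k}_q\,E^I_{k+1}(q;x,y)\,E^I_{n-k-1}(q;x,y). \]
   Context: An increasing binary tree on $[m]=\{1,\dots,m\}$ is a rooted tree on $[m]$ with labels increasing along paths from the root, each vertex having at most one (distinguished) left child and at most one right child. $\mathcal{T}^I_m$ is the set of André I trees on $[m]$: increasing binary trees in which, for every vertex with at least one child, the maximum label of the left subtree is less than the maximum label of the right subtree (maximum of the empty tree $=0$). $l(T)$ is the number of leaves, $u(T)$ the number of vertices with exactly one child. An inversion of $T$ is a pair $(i,j)$ of vertices with $i>j$ such that either (1) $j$ belongs to the right subtree of some vertex $v$ on the path from the root to $i$ whose left child is on that path; or (2) $j$ is on the path from the root to $i$ and the left child of $j$ is on that path; $\operatorname{inv}(T)$ counts inversions. ${n\brack k}_q=\frac{(q;q)_n}{(q;q)_k(q;q)_{n-k}}$ for $0\le k\le n$, with $(q;q)_n=\prod_{i=1}^n(1-q^i)$. *)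

(* Defs.v *)
From mathcomp Require Import all_boot all_order all_algebra.
Set Implicit Arguments. Unset Strict Implicit. Unset Printing Implicit Defensive.
Import GRing.Theory.

(* An increasing binary tree on [m] is encoded by a finite function
   f : 'I_m -> 'I_m * bool.  Vertex v : 'I_m carries label v+1 (an
   order-preserving relabelling of [m]).  For v <> 0, f v = (p, b) says that
   v is the left (b = false) or right (b = true) child of its parent p < v.
   Vertex 0 is the root, normalised by f 0 = (0, false).  Two non-root
   vertices cannot occupy the same (parent, side) slot. *)

Section Trees.
Variable m : nat.
Implicit Types (f : {ffun 'I_m -> 'I_m * bool}) (u v w c r i j : 'I_m).

Definition par f v : 'I_m := (f v).1.

Definition is_inc_tree f : bool :=
  [forall v : 'I_m, if val v == 0%N then f v == (v, false)
                    else (val (par f v) < val v)%N] &&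
  [forall v : 'I_m, forall w : 'I_m,
     [&& (0 < val v)%N, (0 < val w)%N & f v == f w] ==> (v == w)].

Definition anc f u v : bool := [exists k : 'I_m, iter k (par f) v == u].

Definition lchild f u c : bool := (0 < val c)%N && (f c == (u, false)).
Definition rchild f u c : bool := (0 < val c)%N && (f c == (u, true)).

(* maximum label of the left / right subtree of u (0 for the empty tree) *)
Definition maxL f u : nat :=
  \max_(w : 'I_m | [exists c : 'I_m, lchild f u c && anc f c w]) (val w).+1.
Definition maxR f u : nat :=
  \max_(w : 'I_m | [exists c : 'I_m, rchild f u c && anc f c w]) (val w).+1.

Definition has_child f u : bool := [exists c : 'I_m, lchild f u c || rchild f u c].

Definition is_andreI f : bool :=
  is_inc_tree f && [forall u : 'I_m, has_child f u ==> (maxL f u < maxR f u)%N].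

Definition nchild f u : nat :=
  (#|[pred c : 'I_m | lchild f u c]| + #|[pred c : 'I_m | rchild f u c]|)%N.

Definition leaves f : nat := #|[pred u : 'I_m | nchild f u == 0%N]|.
Definition unary f : nat := #|[pred u : 'I_m | nchild f u == 1%N]|.

Definition inv_pair f i j : bool :=
  (val j < val i)%N &&
  ([exists v : 'I_m, exists c : 'I_m, exists r : 'I_m,
      [&& anc f v i, lchild f v c, anc f c i, rchild f v r & anc f r j]]
   || [exists c : 'I_m, [&& anc f j i, lchild f j c & anc f c i]]).

Definition inv f : nat := #|[pred p : 'I_m * 'I_m | inv_pair f p.1 p.2]|.

End Trees.

Local Open Scope ring_scope.

Definition qpoch (R : fieldType) (q : R) (n : nat) : R :=
  \prod_(1 <= i < n.+1) (1 - q ^+ i).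
Definition qbinom (R : fieldType) (q : R) (n k : nat) : R :=
  qpoch q n / (qpoch q k * qpoch q (n - k)).

Definition EI (R : fieldType) (q x y : R) (m : nat) : R :=
  if m is 0 then x else
  \sum_(f : {ffun 'I_m -> 'I_m * bool} | is_andreI f)
     x ^+ leaves f * y ^+ unary f * q ^+ inv f.

(* Main.v *)
(* Decompose an André I tree on n+1 vertices at its root: the root, the left subtree
   and the right subtree, each subtree relabelled increasingly.  The tree is determined
   by the vertex set A of the right subtree together with the two relabelled trees, and
   the André condition at the root says exactly that A contains the largest label.
   The root contributes one inversion for each vertex i of the left subtree, and the
   only other inversions not internal to a subtree are the pairs i > j with i in the
   left subtree and j in A.  Summed over all A of a given size, q to the number of these
   crossing pairs satisfies the q-Pascal recurrence, hence is a q-binomial coefficient.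
   An empty left subtree makes the root unary, which gives the separate term y E_n. *)
Require Import Defs.
From mathcomp Require Import all_boot all_order all_algebra.
From mathcomp Require Import zify ring.
Set Implicit Arguments. Unset Strict Implicit. Unset Printing Implicit Defensive.
Import GRing.Theory.
Local Open Scope ring_scope.

(** * q-binomial coefficients and subsets *)

Section Gauss.
Variables (R : fieldType) (q : R).

(** The Gaussian binomial coefficient, given by the q-Pascal rule so that no division occurs and
    every value of [q] is allowed. *)
Fixpoint gauss m k : R :=
  match m, k with
  | _, 0 => 1
  | 0, _.+1 => 0
  | m'.+1, k'.+1 => gauss m' k' + q ^+ k * gauss m' k
  end.

Lemma gauss0r m : gauss m 0 = 1. Proof. by case: m. Qed.

Lemma gauss_small m k : (m < k)%N -> gauss m k = 0.
Proof.
elim: m k => [|m IHm] [|k] //= lt_mk.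
by rewrite !IHm ?mulr0 ?addr0 // ltnW.
Qed.

Lemma gaussnn m : gauss m m = 1.
Proof. by elim: m => //= m ->; rewrite gauss_small // mulr0 addr0. Qed.

Lemma qpochS n : qpoch q n.+1 = qpoch q n * (1 - q ^+ n.+1).
Proof. by rewrite /qpoch big_nat_recr. Qed.

Lemma gauss_qpoch m k : (k <= m)%N ->
  gauss m k * (qpoch q k * qpoch q (m - k)) = qpoch q m.
Proof.
have qp0 : qpoch q 0 = 1 by rewrite /qpoch big_geq.
elim: m k => [|m IHm] [|k] //= le_km; rewrite ?qp0 ?mul1r ?subn0 //.
rewrite subSS; have IHk := IHm k le_km.
have [lt_km | ge_mk] := ltnP k m; last first.
  have {le_km ge_mk} e_km : k = m by lia.
  subst k; move: IHk; rewrite gaussnn gauss_small // subnn qp0 !mulr1 mul1r => _.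
  by rewrite mulr0 addr0 mul1r.
move: IHk (IHm k.+1 lt_km); have -> : (m - k = (m - k.+1).+1)%N by lia.
rewrite !qpochS => IHk IHk1.
(* The q-Pascal step rests on 1 - q^(m+1) = (1 - q^(k+1)) + q^(k+1) (1 - q^(m-k)). *)
have e_q : q ^+ m.+1 = q ^+ k.+1 * q ^+ (m - k.+1).+1 by rewrite -exprD; congr (_ ^+ _); lia.
transitivity (qpoch q m * (1 - q ^+ k.+1)
   + q ^+ k.+1 * (qpoch q m * (1 - q ^+ (m - k.+1).+1))); last by rewrite e_q; ring.
by rewrite -{1}IHk -IHk1; ring.
Qed.

(** By [gauss_qpoch] the denominator divides [qpoch q m], so it is nonzero as well and can be
    cancelled. *)
Lemma qbinom_gauss m k : (k <= m)%N -> qpoch q m != 0 -> qbinom q m k = gauss m k.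
Proof.
move=> /gauss_qpoch Eg; rewrite /qbinom -Eg => nz; rewrite mulfK //.
by apply: contraNneq nz => ->; rewrite mulr0.
Qed.

End Gauss.

Lemma sum_subset_setU1 (V : nmodType) (T : finType) (x : T) (D : {set T})
    (F : {set T} -> V) : x \notin D ->
  \sum_(A : {set T} | A \subset x |: D) F A =
  \sum_(A : {set T} | A \subset D) (F A + F (x |: A)).
Proof.
move=> xD; rewrite (bigID (fun A : {set T} => x \notin A)) big_split /=.
have notin (A : {set T}) : A \subset D -> x \notin A.
  by move=> sAD; apply: contra xD => /(subsetP sAD).
congr (_ + _).
  apply: eq_bigl => A; apply/andP/idP => [[sA xA] | sAD].
    by apply/subsetP => y yA; have /setU1P[eyx|] := subsetP sA y yA; first by rewrite -eyx yA in xA.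
  by rewrite notin // (subset_trans sAD) // subsetUr.
rewrite (reindex_onto (fun A => x |: A) (fun A => A :\ x)) /=; last first.
  by move=> A /andP[_ /negPn xA]; rewrite setD1K.
apply: eq_bigl => A; rewrite setU11 andbT; apply/andP/idP => [[sA /eqP<-]|sAD].
  by rewrite subDset.
by rewrite setUS // setU1K ?notin.
Qed.

(** * Crossing pairs between a set of vertices and its complement *)

Section Crossings.
Variable N : nat.
Implicit Types (t : 'I_N) (D A : {set 'I_N}).

(** With [A] the right and [D :\: A] the left vertex set, these are the inversions running between
    the two subtrees. *)
Definition crossing D A : nat := \sum_(i in D :\: A) #|[set j in A | (j < i)%N]|.

(** Index 0 is left out because it is the root. *)
Definition upto m : {set 'I_N} := [set i : 'I_N | (0 < i <= m)%N].

Lemma uptoS t m : val t = m.+1 -> upto m.+1 = t |: upto m.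
Proof. by move=> e; apply/setP => i; rewrite !inE -val_eqE e; case: i => i /= _; lia. Qed.

Lemma crossing_top t D A : A \subset D -> (forall j, j \in D -> (j < t)%N) ->
  crossing (t |: D) A = (#|A| + crossing D A)%N.
Proof.
move=> sAD ltD; have tD : t \notin D by apply/negP => /ltD; rewrite ltnn.
have tA : t \notin A by apply: contra tD => /(subsetP sAD).
rewrite /crossing (bigD1 t) ?inE ?eqxx ?tA //=; congr (_ + _)%N.
  apply: eq_card => j; rewrite inE; case jA: (j \in A) => //=.
  by rewrite ltD // (subsetP sAD).
apply: eq_bigl => i; rewrite !inE; have [->|] := eqVneq i t; rewrite ?andbF ?andbT //=.
by rewrite (negPf tD) andbF.
Qed.

Lemma crossing_topU t D A : (forall j, j \in D -> (j < t)%N) ->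
  crossing (t |: D) (t |: A) = crossing D A.
Proof.
move=> ltD; have tD : t \notin D by apply/negP => /ltD; rewrite ltnn.
rewrite /crossing; apply: eq_big => [i|i].
  rewrite !inE; have [->|] //= := eqVneq i t; by rewrite (negPf tD) andbF.
rewrite !inE => /andP[/norP[ni _]]; rewrite (negPf ni) /= => /ltD lti.
by apply: eq_card => j; rewrite !inE; have [->|] //= := eqVneq j t; rewrite ltnNge (ltnW lti) andbF.
Qed.

(** Induction on [m], by whether the top element [m.+1] lies in [A]. Inside [A] it is below nothing
    and adds no crossing; outside it is above all of [A] and adds [#|A|] crossings. The two cases
    are the two terms of q-Pascal. *)
Lemma crossing_gauss (R : fieldType) (q : R) m k : (m < N)%N ->
  \sum_(A : {set 'I_N} | (A \subset upto m) && (#|A| == k)) q ^+ crossing (upto m) A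
  = gauss q m k.
Proof.
elim: m k => [|m IHm] k ltmN.
  have -> : upto 0 = set0 by apply/setP => i; rewrite !inE; lia.
  case: k => [|k] /=.
    rewrite (big_pred1 set0) => [|A]; first by rewrite /crossing set0D big_set0.
    rewrite subset0 /=; have [->|] := eqVneq A set0; by rewrite ?cards0 ?eqxx.
  by rewrite big_pred0 // => A; rewrite subset0; case: eqVneq => [->|] //; rewrite cards0.
set t := Ordinal ltmN; rewrite (@uptoS t m erefl).
have tD : t \notin upto m by rewrite inE /= ltnn.
have ltD (j : 'I_N) : j \in upto m -> (j < t)%N by rewrite inE => /andP[].
rewrite big_mkcondr sum_subset_setU1 // big_split /= addrC -!big_mkcondr.
have cU (A : {set 'I_N}) : A \subset upto m -> #|t |: A| = #|A|.+1.
  by move=> sA; rewrite cardsU1 (contra (subsetP sA t)).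
case: k => [|k].
  rewrite big1 ?add0r => [|A /andP[/cU->]] //.
  transitivity (gauss q m 0); last by rewrite gauss0r.
  rewrite -IHm ?(ltnW ltmN) //; apply: eq_bigr => A /andP[sA /eqP cA].
  by rewrite crossing_top // cA.
congr (_ + _).
  rewrite -IHm ?(ltnW ltmN) //; apply: eq_big => [A|A _]; last by rewrite crossing_topU.
  by case sA: (A \subset _) => //=; rewrite cU.
rewrite -IHm ?(ltnW ltmN) // mulr_sumr; apply: eq_bigr => A /andP[sA /eqP cA].
by rewrite crossing_top // cA exprD.
Qed.

End Crossings.

(** * Subtrees of an increasing tree *)

Section Descendants.
Variable m : nat.
Implicit Types (f : {ffun 'I_m -> 'I_m * bool}) (u v w c i j : 'I_m) (b : bool).

Lemma is_inc_treeP f : reflect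
  [/\ forall v, val v = 0 -> f v = (v, false),
      forall v, 0 < v -> par f v < v
    & forall v w, 0 < v -> 0 < w -> f v = f w -> v = w]%N
  (is_inc_tree f).
Proof.
apply: (iffP andP) => [[/forallP H1 /forallP H2] | [H0 H1 H2]].
  split=> [v v0|v v0|v w v0 w0 e].
  - by have := H1 v; rewrite v0 eqxx => /eqP.
  - by have := H1 v; rewrite gtn_eqF.
  - by have /forallP/(_ w) := H2 v; rewrite v0 w0 e eqxx => /eqP.
split; apply/forallP => v; first by case: posnP => [/H0/eqP|/H1].
by apply/forallP => w; apply/implyP => /and3P[v0 w0 /eqP e]; apply/eqP/H2.
Qed.

(** Convertible to [lchild] or [rchild] according to [b], so that both sides share one argument. *)
Definition is_child f b u c : bool := (0 < val c)%N && (f c == (u, b)).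

(* [w] lies in the left ([b = false]) or right ([b = true]) subtree of [u]. *)
Definition in_subtree f b u w : bool := [exists c, is_child f b u c && anc f c w].

Variable f : {ffun 'I_m -> 'I_m * bool}.
Hypothesis inc_f : is_inc_tree f.

(** Each step to the parent lowers the label until the root is reached. *)
Lemma iter_par_le k v : (iter k (par f) v <= v - k)%N.
Proof.
have [H0 H1 _] := is_inc_treeP _ inc_f.
elim: k => [|k IHk]; first by rewrite subn0.
rewrite iterS; set w := iter k _ _ in IHk *.
have [w0|w0] := posnP w; last by have := H1 w w0; lia.
by rewrite /par H0 //= -/(val w) w0.
Qed.

Lemma ancP u v : reflect (exists k, iter k (par f) v = u) (anc f u v).
Proof.
apply: (iffP existsP) => [[k /eqP <-]|[k e]]; first by exists k.
have [lt_km|le_mk] := ltnP k m; first by exists (Ordinal lt_km); rewrite /= e.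
(* The definition of [anc] allows only exponents below [m]. When [k] is at least [m], both [k] and
   [v] steps from [v] end at the root, so [v] serves as exponent. *)
exists v; apply/eqP/val_inj => /=; rewrite -e.
by have /= := iter_par_le v v; have /= := iter_par_le k v; have := ltn_ord v; lia.
Qed.

Lemma anc_rec u v : anc f u v = (u == v) || ((0 < v)%N && anc f u (par f v)).
Proof.
have [H0 _ _] := is_inc_treeP _ inc_f.
apply/ancP/orP => [[[|k] e]|[/eqP e|/andP[_ /ancP[k e]]]].
- by left; rewrite -e.
- have [v0|v0] := posnP v; [left|right]; last by apply/ancP; exists k; rewrite -iterSr.
  have fix_v : par f v = v by rewrite /par H0.
  by apply/eqP; rewrite -e; elim: k.+1 => //= k' ->.
- by exists 0%N.
- by exists k.+1; rewrite iterSr.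
Qed.

(** Peels off the edge from [w] to its parent, which turns subtree membership into an induction on
    labels. *)
Lemma in_subtree_rec b u w : in_subtree f b u w =
  (0 < w)%N && ((f w == (u, b)) || in_subtree f b u (par f w)).
Proof.
rewrite /in_subtree; apply/existsP/andP => [[c /andP[/[dup] fc /andP[c0 fcu]]]|[w0]].
  rewrite anc_rec => /orP[/eqP<-|/andP[-> ac]]; first by rewrite c0 fcu.
  by split=> //; apply/orP; right; apply/existsP; exists c; rewrite fc.
case/orP => [fw|/existsP[c /andP[fc ac]]].
  by exists w; rewrite /is_child w0 fw anc_rec eqxx.
by exists c; rewrite fc anc_rec w0 ac orbT.
Qed.

Lemma child_in_subtree b u c : is_child f b u c -> in_subtree f b u c.
Proof. by rewrite in_subtree_rec => /andP[-> ->]. Qed.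

(** If a child of [v] is on the path from the root to [i], one more step up reaches [v]; the path
    conditions thus become subtree membership. *)
Lemma inv_pair_subtree i j : Defs.inv_pair f i j = (j < i)%N &&
  ([exists v, in_subtree f false v i && in_subtree f true v j] || in_subtree f false j i).
Proof.
rewrite /Defs.inv_pair; congr (_ && (_ || _)).
  apply/existsP/existsP => [[v /existsP[c /existsP[r /and5P[_ lc ci rr rj]]]]|].
    by exists v; apply/andP; split; apply/existsP; [exists c | exists r]; apply/andP.
  case=> v /andP[/existsP[c /andP[lc ci]] /existsP[r /andP[rr rj]]].
  exists v; apply/existsP; exists c; apply/existsP; exists r;
  rewrite -/(is_child f false v c) in lc.
  apply/and5P; split=> //; have [k e] := ancP _ _ ci; apply/ancP; exists k.+1.
  by case/andP: lc => _ /eqP fc; rewrite iterS e /par fc.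
apply/existsP/existsP => [[c /and3P[_ lc ci]]|[c /andP[lc ci]]].
  by exists c; apply/andP.
exists c; apply/and3P; split=> //; have [k e] := ancP _ _ ci; apply/ancP; exists k.+1.
by case/andP: lc => _ /eqP fc; rewrite iterS e /par fc.
Qed.

(** The André condition in terms of order alone, without maxima, so that it transports along
    increasing relabellings. *)
Definition andre_at u : Prop := forall b c, is_child f b u c ->
  exists2 r, in_subtree f true u r & forall l, in_subtree f false u l -> (l < r)%N.

Lemma andre_atP u : reflect (andre_at u) (has_child f u ==> (maxL f u < maxR f u)%N).
Proof.
have E : (maxL f u < maxR f u)%N <->
  exists2 r, in_subtree f true u r & forall l, in_subtree f false u l -> (l < r)%N.
  split=> [ltLR | [r br ltr]].
    (* A strict inequality makes [maxR] positive, so the right subtree is nonempty and its maximum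
       is attained. *)
    have [r br emax] : {r | in_subtree f true u r & maxR f u = r.+1}.
      apply: eq_bigmax_cond; rewrite lt0n; apply/eqP => c0.
      by move: ltLR; rewrite /maxR big_pred0 // => r; exact: (card0_eq c0).
    exists r => // l bl; have : (l < maxL f u)%N by exact: leq_bigmax_cond.
    by move: ltLR; rewrite emax; lia.
  apply: (@leq_trans r.+1); last exact: leq_bigmax_cond.
  by rewrite ltnS; apply/bigmax_leqP => l /ltr.
apply: (iffP implyP) => [H b c bc | H /existsP[c Hc]].
  by apply/E/H/existsP; exists c; case: b bc;
    rewrite /is_child /lchild /rchild => ->; rewrite ?orbT.
by apply/E; case/orP: Hc; exact: H.
Qed.

End Descendants.

(** * Joining two trees under a root *)

(** Enumerating a set of ordinals filters the increasing list of all of them, so [enum_val] is an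
    increasing relabelling. *)
Lemma enum_val_ltn n (A : {set 'I_n}) (i j : 'I_#|A|) :
  (enum_val i < enum_val j)%N = (i < j)%N.
Proof.
have sA : sorted ltn [seq val x | x <- enum A].
  rewrite /enum_mem -enumT sorted_map /=; apply: sorted_filter.
    by move=> ? ? ?; exact: ltn_trans.
  by rewrite -sorted_map val_enum_ord iota_ltn_sorted.
have nthE (k : 'I_#|A|) : val (enum_val k) = nth 0%N [seq val x | x <- enum A] k.
  by rewrite (nth_map (enum_val k)) -?enum_val_nth // -cardE.
have lti : {in gtn #|A| &, {homo nth 0%N [seq val x | x <- enum A] : a b / (a < b)%N}}.
  move=> a b la lb; apply: sorted_ltn_nth sA _ _ _ _; rewrite ?inE ?size_map -?cardE //.
  exact: ltn_trans.
have [lt|lt|/val_inj ->] := ltngtP i j; last by rewrite ltnn.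
  by rewrite !nthE lti ?inE.
by rewrite ltnNge ltnW // !nthE lti ?inE.
Qed.

Section Join.
Variables (n : nat) (A : {set 'I_n.+1}).
Hypothesis A0 : ord0 \notin A.

(* The vertex sets of the left ([s = false]) and right ([s = true]) subtrees of the
   root, [A] being the right one. *)
Definition side (s : bool) : {set 'I_n.+1} := if s then A else ~: (ord0 |: A).

Definition emb s (i : 'I_#|side s|) : 'I_n.+1 := enum_val i.
Arguments emb s i : clear implicits.

Notation family := (forall s, {ffun 'I_#|side s| -> 'I_#|side s| * bool}).
Implicit Types (f : {ffun 'I_n.+1 -> 'I_n.+1 * bool}) (g : family) (s b : bool) (u v w : 'I_n.+1).

Lemma emb_side s i : emb s i \in side s. Proof. exact: enum_valP. Qed.

Lemma emb_A s i : (emb s i \in A) = s.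
Proof. by have := emb_side i; case: s i => i; rewrite ?inE => // /norP[_ /negPf]. Qed.

Lemma emb_neq0 s i : (emb s i == ord0) = false.
Proof.
apply/negP => /eqP e; have := emb_side i.
by rewrite e; case: s i e => i _; rewrite ?inE ?eqxx // (negPf A0).
Qed.

Lemma emb_gt0 s i : (0 < emb s i)%N.
Proof.
rewrite lt0n; apply/negP => /(_ =P 0%N :> nat) e.
by have := emb_neq0 i; rewrite -val_eqE /= e.
Qed.

Lemma emb_inj s : injective (emb s). Proof. exact: enum_val_inj. Qed.

Lemma emb_lt s i j : (emb s i < emb s j)%N = (i < j)%N.
Proof. exact: enum_val_ltn. Qed.

Lemma emb_diff s t i j : s != t -> (emb s i == emb t j) = false.
Proof.
move=> st; apply/negP => /eqP e.
by have := emb_A i; rewrite e emb_A => /esym/eqP; apply/negP.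
Qed.

Lemma embP s v : v \in side s -> exists i, v = emb s i.
Proof. by move=> vs; exists (enum_rank_in vs v); rewrite /emb enum_rankK_in. Qed.

Lemma vertexP v : v = ord0 \/ exists s i, v = emb s i.
Proof.
case: (eqVneq v ord0) => [|v0]; [by left | right].
have [vA|vA] := boolP (v \in A); [exists true | exists false]; apply: embP => //.
by rewrite !inE negb_or v0.
Qed.

Lemma sum_vertices (F : 'I_n.+1 -> nat) :
  (\sum_v F v = F ord0 + \sum_s \sum_i F (emb s i))%N.
Proof.
rewrite big_bool /= (bigD1 ord0) //=; congr (_ + _)%N.
rewrite (bigID (mem A)) /=; congr (_ + _)%N.
  rewrite -[RHS](big_enum_val (A := mem A)); apply: eq_bigl => v /=.
  by case vA: (v \in A); rewrite ?andbF ?andbT //; apply: contraNneq A0 => <-.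
rewrite -[RHS](big_enum_val (A := mem (side false))); apply: eq_bigl => v /=.
by rewrite !inE negb_or.
Qed.

(** A relation rather than a function, so that the statistics apply equally to trees built by [glue]
    and trees cut by [split]. Label 0 of each part is its local root and hangs directly under
    [ord0]. *)
Definition joins f g : Prop := f ord0 = (ord0, false) /\
  forall s i, f (emb s i) =
    if val i == 0%N then (ord0, s) else (emb s (g s i).1, (g s i).2).

(** The [pick] inverts [emb]; it fails only at [ord0], where the default is the root
    normalisation. *)
Definition glue g : {ffun 'I_n.+1 -> 'I_n.+1 * bool} :=
  [ffun v => if [pick i | emb (v \in A) i == v] is Some i then
     if val i == 0%N then (ord0, v \in A) else (emb _ (g _ i).1, (g _ i).2)
   else (v, false)].

(* The value [(i, false)] at the least label is the root normalisation of
   [is_inc_tree], not information read off [f]. *)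
Definition split f s : {ffun 'I_#|side s| -> 'I_#|side s| * bool} :=
  [ffun i => if val i == 0%N then (i, false) else
     odflt (i, false) [pick x | (emb s x.1, x.2) == f (emb s i)]].

Lemma glueP g : joins (glue g) g.
Proof.
split=> [|s i]; rewrite ffunE.
  by case: pickP => // j /eqP e; have := emb_neq0 j; rewrite e eqxx.
by rewrite emb_A; case: pickP => [j /eqP/emb_inj -> //|/(_ i)]; rewrite eqxx.
Qed.

Lemma joins_inj f f' g : joins f g -> joins f' g -> f = f'.
Proof.
move=> [f0 fe] [f0' fe']; apply/ffunP => v.
by have [->|[s [i ->]]] := vertexP v; rewrite ?f0 ?fe ?f0' ?fe'.
Qed.

(** At label 0 [joins] records nothing of [g], so the value there comes from the normalisation
    hypothesis. *)
Lemma joins_split f g s : joins f g ->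
  (forall i : 'I_#|side s|, val i = 0%N -> g s i = (i, false)) -> split f s = g s.
Proof.
move=> [_ fe] g0; apply/ffunP => i; rewrite ffunE fe; case: eqP => [/g0->//|_].
case: pickP => [[a b] /eqP[/emb_inj -> ->] /=|/(_ (g s i))]; last by rewrite eqxx.
by case: (g s i).
Qed.

Lemma joins_inc f g : joins f g -> (forall s, is_inc_tree (g s)) -> is_inc_tree f.
Proof.
move=> [f0 fe] inc_g; apply/is_inc_treeP; split=> [v v0|v v0|v w v0 w0].
- by have -> : v = ord0 by apply: val_inj.
- have [e|[s [i ->]]] := vertexP v; first by rewrite e in v0.
  have [_ g1 _] := is_inc_treeP _ (inc_g s).
  by rewrite /par fe; case: posnP => [_|/g1 lt]; rewrite ?emb_gt0 ?emb_lt.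
have [e|[s [i ->]]] := vertexP v; first by rewrite e in v0.
have [e|[t [j ->]]] := vertexP w; first by rewrite e in w0.
rewrite !fe; case: (posnP i) => i0; case: (posnP j) => j0.
- by case=> est; subst t; congr (emb s _); apply: val_inj; rewrite /= i0 j0.
- by case=> /esym/eqP; rewrite emb_neq0.
- by case=> /eqP; rewrite emb_neq0.
have [est|st] := eqVneq s t; last by case=> /eqP; rewrite emb_diff.
subst t; case=> /emb_inj e1 e2; have [_ _ g2] := is_inc_treeP _ (inc_g s).
by congr (emb s _); apply: g2 => //; move: e1 e2; case: (g s i) (g s j) => ? ? [? ?] /= -> ->.
Qed.

Lemma inc_joins f g s : joins f g -> is_inc_tree f ->
  (forall i : 'I_#|side s|, val i = 0%N -> g s i = (i, false)) -> is_inc_tree (g s).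
Proof.
move=> [f0 fe] /is_inc_treeP[_ f1 f2] g0; apply/is_inc_treeP; split=> // [i i0|i j i0 j0 e].
  by have := f1 (emb s i) (emb_gt0 i); rewrite /par fe gtn_eqF //= emb_lt.
by apply: (@emb_inj s); apply: f2; rewrite ?emb_gt0 ?fe // !gtn_eqF // e.
Qed.

Lemma in_subtree_ord0 f b u : is_inc_tree f -> in_subtree f b u ord0 = false.
Proof. by move=> inc_f; rewrite in_subtree_rec. Qed.

(** Climbing from [v] ends at a child of the root, and the side of that child decides. *)
Lemma in_subtree_sides f v : is_inc_tree f -> (0 < v)%N ->
  in_subtree f false ord0 v = ~~ in_subtree f true ord0 v.
Proof.
move=> inc_f; have [_ f1 _] := is_inc_treeP _ inc_f.
have [k] := ubnP (val v); elim: k v => // k IHk v lt_vk v0.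
rewrite !(in_subtree_rec inc_f _ _ v) v0 /=.
have := f1 v v0; rewrite /par; case: (f v) => p b /= lt_pv.
have [p0|p0] := posnP p.
  have -> : p = ord0 by apply: val_inj.
  by rewrite !in_subtree_ord0 // !xpair_eqE eqxx; case: b.
rewrite !xpair_eqE (_ : (p == ord0) = false) /= ?IHk //; last by rewrite -val_eqE /= gtn_eqF.
exact: leq_trans lt_pv lt_vk.
Qed.

Lemma in_subtree_side f b v : is_inc_tree f -> [set w | in_subtree f true ord0 w] = A ->
  in_subtree f b ord0 v = (v \in side b).
Proof.
move=> inc_f defA; have [->|v0] := eqVneq v ord0.
  by rewrite in_subtree_ord0 //; case: b; rewrite /side ?inE ?eqxx ?(negPf A0).
case: b; first by rewrite /side -defA inE.
by rewrite /side in_subtree_sides ?lt0n // !inE negb_or v0 -defA inE.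
Qed.

Lemma split_joins f : is_inc_tree f -> [set w | in_subtree f true ord0 w] = A ->
  joins f (split f).
Proof.
move=> inc_f defA; have [f0 f1 f2] := is_inc_treeP _ inc_f.
split=> [|s i]; first exact: f0.
have sideE b v := in_subtree_side b v inc_f defA.
have i0 := emb_gt0 i; have := f1 _ i0; have := sideE s (emb s i); rewrite emb_side.
rewrite in_subtree_rec // i0 /=; rewrite ffunE /par; case def_fi: (f (emb s i)) => [p b] /=.
have [p0|p_neq0] := eqVneq p ord0.
  rewrite {p}p0 in_subtree_ord0 // orbF xpair_eqE eqxx /= in def_fi * => /eqP e_b _; subst b.
  have [//|i_gt0] := posnP i.
  have k0 : (0 < #|side s|)%N by case: (i) => /= x /(leq_ltn_trans _); apply.
  pose i1 := Ordinal k0; have j0 := emb_gt0 i1.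
  (* The least vertex [i1] of the side has no smaller vertex there to be its parent, so it occupies
     the slot [(ord0, s)] too. Uniqueness of slots then gives [i = i1], against [i > 0]. *)
  suff e1 : f (emb s i1) = f (emb s i).
    by have := emb_inj (f2 _ _ j0 i0 e1) => /(congr1 val)/= e; rewrite -e in i_gt0.
  rewrite def_fi; have := f1 _ j0; have := sideE s (emb s i1); rewrite emb_side.
  rewrite in_subtree_rec // j0 /=; case/orP => [/eqP //|]; rewrite sideE => /embP[j ->].
  by rewrite emb_lt.
rewrite xpair_eqE (negPf p_neq0) /= sideE => /embP[j ->]; rewrite emb_lt => lt_ji.
rewrite gtn_eqF; last exact: leq_ltn_trans lt_ji.
by case: pickP => [[a c] /eqP[/emb_inj -> ->] //|/(_ (j, b))]; rewrite eqxx.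
Qed.

End Join.

Arguments emb [n] A s i.

(** * Statistics of a joined tree *)

(** Statistics become sums of Booleans, which [sum_vertices] splits over the root and the two
    sides. *)
Lemma card_sum (T : finType) (P : pred T) : #|[pred x | P x]| = (\sum_x (P x : nat))%N.
Proof. by rewrite -sum1_card big_mkcond; apply: eq_bigr => x _; rewrite inE; case: (P x). Qed.

Lemma nchild_sum m (f : {ffun 'I_m -> 'I_m * bool}) u :
  nchild f u = (\sum_b \sum_c (is_child f b u c : nat))%N.
Proof. by rewrite big_bool /= addnC -!card_sum. Qed.

Lemma leaves_sum m (f : {ffun 'I_m -> 'I_m * bool}) :
  leaves f = (\sum_u (nchild f u == 0 : nat))%N.
Proof. exact: card_sum. Qed.

Lemma unary_sum m (f : {ffun 'I_m -> 'I_m * bool}) :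
  unary f = (\sum_u (nchild f u == 1 : nat))%N.
Proof. exact: card_sum. Qed.

Lemma inv_sum m (f : {ffun 'I_m -> 'I_m * bool}) :
  Defs.inv f = (\sum_i \sum_j (Defs.inv_pair f i j : nat))%N.
Proof. by rewrite /Defs.inv card_sum pair_bigA. Qed.

Section JoinStatistics.
Variables (n : nat) (A : {set 'I_n.+1}).
Hypothesis A0 : ord0 \notin A.
Variables (f : {ffun 'I_n.+1 -> 'I_n.+1 * bool})
  (g : forall s, {ffun 'I_#|side A s| -> 'I_#|side A s| * bool}).
Hypotheses (fg : joins f g) (inc_f : is_inc_tree f)
  (inc_g : forall s, is_inc_tree (g s)).
Implicit Types (s b : bool).
Local Notation emb := (emb A).

Lemma is_child_emb s b u c : is_child f b (emb s u) (emb s c) = is_child (g s) b u c.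
Proof.
case: fg => _ fe; rewrite /is_child fe /= emb_gt0 //=; case: posnP => [_|_] /=.
  by rewrite xpair_eqE eq_sym emb_neq0.
by rewrite [g s c]surjective_pairing !xpair_eqE (inj_eq (@emb_inj _ _ s)).
Qed.

Lemma is_child_emb_diff s t b u c : s != t -> is_child f b (emb s u) (emb t c) = false.
Proof.
case: fg => _ fe st; rewrite /is_child fe /= emb_gt0 //=; case: posnP => [_|_] /=.
  by rewrite xpair_eqE eq_sym emb_neq0.
by rewrite xpair_eqE emb_diff // eq_sym.
Qed.

Lemma is_child_root b s c : is_child f b ord0 (emb s c) = (val c == 0%N) && (s == b).
Proof.
case: fg => _ fe; rewrite /is_child fe /= emb_gt0 //=; case: posnP => [_|_] /=.
  by rewrite xpair_eqE eqxx.
by rewrite xpair_eqE emb_neq0.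
Qed.

(** Strong induction on the label of [c], one parent at a time; the climb leaves the side only at
    label 0, whose parent in [f] is the root. *)
Lemma in_subtree_emb s b u c : in_subtree f b (emb s u) (emb s c) = in_subtree (g s) b u c.
Proof.
have [_ g1 _] := is_inc_treeP _ (inc_g s).
have [k] := ubnP (val c); elim: k c => // k IHk c lt_ck.
rewrite !(in_subtree_rec _ b _ (emb s c)) // (in_subtree_rec (inc_g s)) emb_gt0 //=.
have := is_child_emb b u c; rewrite /is_child emb_gt0 //= => ->.
case: fg => _ fe; rewrite /par fe; case: posnP => [_|c0] /=; first by rewrite in_subtree_ord0.
by rewrite IHk //; apply: leq_trans (g1 c c0) lt_ck.
Qed.

Lemma in_subtree_emb_diff s t b u c : s != t -> in_subtree f b (emb s u) (emb t c) = false.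
Proof.
move=> st; have [_ g1 _] := is_inc_treeP _ (inc_g t).
have [k] := ubnP (val c); elim: k c => // k IHk c lt_ck.
rewrite (in_subtree_rec inc_f) emb_gt0 //=.
have := is_child_emb_diff b u c st; rewrite /is_child emb_gt0 //= => ->.
case: fg => _ fe; rewrite /par fe; case: posnP => [_|c0] /=; first by rewrite in_subtree_ord0.
by rewrite IHk //; apply: leq_trans (g1 c c0) lt_ck.
Qed.

Lemma in_subtree_root b s c : in_subtree f b ord0 (emb s c) = (s == b).
Proof.
have [_ g1 _] := is_inc_treeP _ (inc_g s).
have [k] := ubnP (val c); elim: k c => // k IHk c lt_ck.
rewrite (in_subtree_rec inc_f) emb_gt0 //=.
have := is_child_root b c; rewrite /is_child emb_gt0 //= => ->.
case: fg => _ fe; rewrite /par fe; case: posnP => [_|c0] /=.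
  by rewrite in_subtree_ord0 // orbF.
by rewrite IHk //; apply: leq_trans (g1 c c0) lt_ck.
Qed.

Lemma in_subtree_true_root : [set w | in_subtree f true ord0 w] = A.
Proof.
apply/setP => w; rewrite inE; have [->|[s [i ->]]] := vertexP A w.
  by rewrite in_subtree_ord0 // (negPf A0).
by rewrite in_subtree_root emb_A; case: s i.
Qed.

(** * The André condition on a joined tree *)

Lemma andre_at_emb s u : andre_at f (emb s u) <-> andre_at (g s) u.
Proof.
have emb_of b v : in_subtree f b (emb s u) v -> exists i, v = emb s i.
  have [->|[t [i ->]]] := vertexP A v; first by rewrite in_subtree_ord0.
  have [est|st] := eqVneq s t; last by rewrite in_subtree_emb_diff.
  by subst t; exists i.
split=> H b c bc.
  have [|r br ltr] := H b (emb s c); first by rewrite is_child_emb.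
  have [i er] := emb_of _ _ br; subst r; exists i; first by rewrite -in_subtree_emb.
  by move=> l bl; rewrite -(@emb_lt _ A); apply: ltr; rewrite in_subtree_emb.
have [i er] := emb_of _ _ (child_in_subtree inc_f bc); subst c.
have [|r br ltr] := H b i; first by rewrite -is_child_emb.
exists (emb s r); first by rewrite in_subtree_emb.
move=> l /[dup] /emb_of[j ->]; rewrite in_subtree_emb emb_lt; exact: ltr.
Qed.

(** No vertex exceeds [ord_max], so it cannot be on the left; on the right it is itself the required
    witness. *)
Lemma andre_at_root : (0 < n)%N -> (andre_at f ord0 <-> ord_max \in A).
Proof.
move=> n0; split=> [H|maxA b c _].
  have [e|[s [i e]]] := vertexP A ord_max.
    by have /= := congr1 val e; lia.
  (* The side holding [ord_max] is nonempty, so its least vertex is a child of the root and the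
     condition applies. *)
  have k0 : (0 < #|side A s|)%N by case: (i) => /= x /(leq_ltn_trans _); apply.
  have [|r br ltr] := H s (emb s (Ordinal k0)); first by rewrite is_child_root !eqxx.
  rewrite e emb_A; case: s i e k0 => // i e k0.
  have := ltr ord_max; rewrite e in_subtree_root -e => /(_ isT).
  by rewrite ltnNge -ltnS ltn_ord.
exists ord_max; first by move: maxA; rewrite -{1}in_subtree_true_root inE.
move=> l; have [->|[t [i ->]]] := vertexP A l; first by rewrite in_subtree_ord0.
rewrite in_subtree_root => /eqP et; subst t; rewrite ltn_neqAle -ltnS ltn_ord andbT.
by apply: contraTneq maxA => /val_inj <-; rewrite emb_A.
Qed.

Lemma is_andreI_joins : (0 < n)%N ->
  is_andreI f = (ord_max \in A) && [forall s, is_andreI (g s)].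
Proof.
move=> n0; rewrite /is_andreI inc_f /=; apply/forallP/andP => [H|[maxA /forallP H] u].
  split; first by apply/(andre_at_root n0)/andre_atP.
  apply/forallP => s; rewrite inc_g; apply/forallP => u.
  by apply/andre_atP => //; apply/andre_at_emb/andre_atP.
apply/andre_atP => //; have [->|[s [i ->]]] := vertexP A u; first exact/andre_at_root.
by apply/andre_at_emb/andre_atP => //; have /andP[_ /forallP] := H s; apply.
Qed.

(** * Leaves and unary vertices of a joined tree *)

Lemma nchild_emb s u : nchild f (emb s u) = nchild (g s) u.
Proof.
rewrite !nchild_sum; apply: eq_bigr => b _; rewrite (sum_vertices A0) add0n.
rewrite (bigD1 s) //= [X in (_ + X)%N]big1 ?addn0 => [|t ts].
  by apply: eq_bigr => c _; rewrite is_child_emb.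
by rewrite big1 // => c _; rewrite is_child_emb_diff // eq_sym.
Qed.

Lemma nchild_root : nchild f ord0 = (\sum_s (0 < #|side A s|)%N)%N.
Proof.
rewrite nchild_sum; apply: eq_bigr => b _; rewrite (sum_vertices A0) add0n.
rewrite (bigD1 b) //= [X in (_ + X)%N]big1 ?addn0 => [|t /negPf tb]; last first.
  by rewrite big1 // => c _; rewrite is_child_root tb andbF.
have [k0|k0] := posnP #|side A b|.
  by rewrite big1 // => -[i lt_i] _; exfalso; rewrite k0 in lt_i.
rewrite (bigD1 (Ordinal k0)) //= is_child_root !eqxx big1 // => c.
by rewrite -val_eqE is_child_root => /negPf/= ->.
Qed.

(** Since [A] is nonempty, the root has a right child and is not a leaf. *)
Lemma leaves_joins : ord_max \in A ->
  leaves f = (leaves (g false) + leaves (g true))%N.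
Proof.
move=> maxA; rewrite !leaves_sum (sum_vertices A0) nchild_root !big_bool /=.
have -> : (0 < #|A|)%N by apply/card_gt0P; exists ord_max.
rewrite [X in (X + _)%N](_ : _ = 0%N) // add0n addnC.
by congr (_ + _)%N; apply: eq_bigr => i _; rewrite nchild_emb.
Qed.

Lemma unary_joins : ord_max \in A ->
  unary f = ((#|side A false| == 0%N) + unary (g false) + unary (g true))%N.
Proof.
move=> maxA; rewrite !unary_sum (sum_vertices A0) nchild_root !big_bool /=.
have -> : (0 < #|A|)%N by apply/card_gt0P; exists ord_max.
rewrite -addnA [X in (_ + X = _)%N]addnC; congr (_ + (_ + _))%N.
- by case: #|_|.
- by apply: eq_bigr => i _; rewrite nchild_emb.
- by apply: eq_bigr => i _; rewrite nchild_emb.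
Qed.

(** * Inversions of a joined tree *)

Lemma inv_pair_emb s i j : Defs.inv_pair f (emb s i) (emb s j) = Defs.inv_pair (g s) i j.
Proof.
rewrite !inv_pair_subtree // emb_lt in_subtree_emb; congr (_ && (_ || _)).
apply/existsP/existsP => [[v]|[v H]]; last by exists (emb s v); rewrite !in_subtree_emb.
(* The separating vertex is not the root, since [i] and [j] lie on the same side. *)
have [->|[t [k ->]]] := vertexP A v.
  by rewrite !in_subtree_root => /andP[/eqP e1 /eqP] e2; rewrite e1 in e2.
have [est|ts] := eqVneq t s; last by rewrite in_subtree_emb_diff.
by subst t; rewrite !in_subtree_emb; exists k.
Qed.

Lemma inv_pair_root s i : Defs.inv_pair f (emb s i) ord0 = ~~ s.
Proof.
rewrite inv_pair_subtree // emb_gt0 //= in_subtree_root; case: existsP => [[v]|_].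
  by rewrite (in_subtree_ord0 true) // andbF.
by case: s i.
Qed.

Lemma inv_pair_left_right i j :
  Defs.inv_pair f (emb false i) (emb true j) = (emb true j < emb false i)%N.
Proof.
rewrite inv_pair_subtree //; case: existsP => [_|[]]; rewrite ?andbT //.
by exists ord0; rewrite !in_subtree_root.
Qed.

Lemma inv_pair_right_left i j : Defs.inv_pair f (emb true i) (emb false j) = false.
Proof.
rewrite inv_pair_subtree // in_subtree_emb_diff // orbF; apply/andP => -[_ /existsP[v]].
have [->|[t [k ->]]] := vertexP A v; first by rewrite !in_subtree_root.
by case: t k => k; [rewrite andbC|]; rewrite in_subtree_emb_diff.
Qed.

Lemma inv_joins : Defs.inv f =
  (#|side A false| + crossing [set~ ord0] A + Defs.inv (g false) + Defs.inv (g true))%N.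
Proof.
rewrite (inv_sum f) (sum_vertices A0) big1 ?add0n => [|j _]; last first.
  by rewrite inv_pair_subtree.
rewrite big_bool /= addnC; congr (_ + _)%N; last first.
  rewrite inv_sum; apply: eq_bigr => i _; rewrite (sum_vertices A0) inv_pair_root add0n.
  rewrite big_bool /= addnC big1 ?add0n => [|j _]; last by rewrite inv_pair_right_left.
  by apply: eq_bigr => j _; rewrite inv_pair_emb.
(* A left vertex is inverted with the root, with each smaller vertex of [A], and with vertices of
   its own subtree. *)
transitivity (\sum_(i < #|side A false|) (1 + #|[set j in A | (j < emb false i)%N]|
   + \sum_j (Defs.inv_pair (g false) i j : nat)))%N.
  apply: eq_bigr => i _; rewrite (sum_vertices A0) inv_pair_root big_bool /= addnA.
  congr (_ + _ + _)%N; last by apply: eq_bigr => j _; rewrite inv_pair_emb.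
  under eq_bigr do rewrite inv_pair_left_right.
  rewrite -[RHS]sum1_card.
  rewrite -(big_enum_val (A := mem A) (fun j : 'I_n.+1 => (j < emb false i)%N : nat)) /=.
  rewrite [RHS](eq_bigl (fun j => (j \in A) && (j < emb false i)%N)) => [|j]; last by rewrite inE.
  by rewrite big_mkcondr; apply: eq_bigr => j _; case: ltnP.
rewrite !big_split /= -inv_sum sum1_card card_ord; congr (_ + _ + _)%N.
rewrite -(big_enum_val (A := mem (side A false))
  (fun i : 'I_n.+1 => #|[set j in A | (j < i)%N]|)) /crossing /=.
by apply: eq_bigl => i; rewrite !inE negb_or andbC.
Qed.

End JoinStatistics.

(** * The recurrence *)

Section Recurrence.
Variables (R : fieldType) (q x y : R).

Definition weight m (f : {ffun 'I_m -> 'I_m * bool}) : R :=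
  x ^+ leaves f * y ^+ unary f * q ^+ Defs.inv f.

Definition andre_sum m : R :=
  \sum_(f : {ffun 'I_m -> 'I_m * bool} | is_andreI f) weight f.

Lemma andre_sum_EI m : (0 < m)%N -> EI q x y m = andre_sum m.
Proof. by case: m. Qed.

(* There is one (empty) tree on no vertices; this is not the convention E_0 = x. *)
Lemma andre_sum0 : andre_sum 0 = 1.
Proof.
pose f0 : {ffun 'I_0 -> 'I_0 * bool} := [ffun i => (i, false)].
rewrite /andre_sum (big_pred1 f0) => [|f].
  rewrite /weight leaves_sum unary_sum inv_sum !big_ord0.
  by rewrite !expr0 !mulr1.
have -> : f = f0 by apply/ffunP => -[].
rewrite /= eqxx; apply/andP; split; last by apply/forallP => -[].
by apply/andP; split; apply/forallP => -[].
Qed.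

Lemma weight_joins n (A : {set 'I_n.+1}) f
    (g : forall s, {ffun 'I_#|side A s| -> 'I_#|side A s| * bool}) :
  ord0 \notin A -> ord_max \in A -> joins f g -> is_inc_tree f ->
  (forall s, is_inc_tree (g s)) ->
  weight f = y ^+ (#|side A false| == 0%N) *
    q ^+ (#|side A false| + crossing [set~ ord0] A) *
    (weight (g false) * weight (g true)).
Proof.
move=> A0 maxA fg inc_f inc_g; rewrite /weight.
rewrite (leaves_joins A0 fg) // (unary_joins A0 fg) // (inv_joins A0 fg) //.
move: (leaves _) (leaves _) (unary _) (unary _) (Defs.inv _) (Defs.inv _) => a b c d i j.
move: (nat_of_bool _) (crossing _ _) => e l; move: #|_| => k; rewrite !exprD; ring.
Qed.

Lemma sum_right_subtree n (A : {set 'I_n.+1}) : (0 < n)%N -> ord0 \notin A ->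
  \sum_(f | is_andreI f && ([set w | in_subtree f true ord0 w] == A)) weight f =
  if ord_max \in A then y ^+ (#|side A false| == 0%N) *
    q ^+ (#|side A false| + crossing [set~ ord0] A) *
    (andre_sum #|side A false| * andre_sum #|A|) else 0.
Proof.
move=> n0 A0.
pose tree s := {ffun 'I_#|side A s| -> 'I_#|side A s| * bool}.
pose both (p : tree false * tree true) s : tree s :=
  if s as s' return tree s' then p.2 else p.1.
pose parts f : tree false * tree true := (split A f false, split A f true).
have joinsE f p : joins (A := A) f (both p) -> f = glue (both p).
  by move/joins_inj; apply; exact: glueP.
rewrite (reindex_onto (fun p => glue (both p)) parts) /=; last first.
  move=> f /andP[/andP[inc_f _] /eqP defA]; apply/esym/joinsE.
  by have [f0 fe] := split_joins A0 inc_f defA; split=> // -[] i; rewrite fe.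
(* Reindexing leaves the condition that [parts] undoes [glue]. It supplies the root normalisation of
   both components at label 0, which [glue] alone would not see. *)
have condE p : is_andreI (glue (both p)) &&
    ([set w | in_subtree (glue (both p)) true ord0 w] == A) &&
    (parts (glue (both p)) == p) =
  [&& ord_max \in A, is_andreI p.1 & is_andreI p.2].
  have jp := glueP A0 (both p).
  have allE : [forall s, is_andreI (both p s)] = is_andreI p.1 && is_andreI p.2.
    by apply/forallP/andP => [|[? ?] []].
  apply/idP/idP => [/andP[/andP[andre_f _] /eqP defp]|/and3P[maxA a1 a2]].
    have inc_f : is_inc_tree (glue (both p)) by case/andP: andre_f.
    rewrite -allE -(is_andreI_joins A0 jp) // => s; apply: (inc_joins A0 jp) => // i i0.
    have -> : both p s = split A (glue (both p)) s by rewrite -{1}defp; case: s i i0.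
    by rewrite ffunE i0.
  have inc_g s : is_inc_tree (both p s) by case: s; [case/andP: a2 | case/andP: a1].
  have inc_f := joins_inc A0 jp inc_g.
  rewrite (is_andreI_joins A0 jp) // maxA allE a1 a2 (in_subtree_true_root A0 jp) // eqxx /=.
  have splitE s : split A (glue (both p)) s = both p s.
    by apply: joins_split => // i i0; have [-> //] := is_inc_treeP _ (inc_g s).
  by rewrite /parts !splitE; case: p {jp allE inc_g inc_f splitE a1 a2}.
rewrite (eq_bigl _ _ condE); case: ifP => maxA; last by rewrite big_pred0.
rewrite /= /andre_sum big_distrlr pair_big_dep mulr_sumr /=.
apply: eq_bigr => p /andP[a1 a2]; have jp := glueP A0 (both p).
have inc_g s : is_inc_tree (both p s) by case: s; [case/andP: a2 | case/andP: a1].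
by rewrite (weight_joins A0 maxA jp) //; exact: (joins_inc A0 jp).
Qed.

Lemma upto_C0 M : [set~ ord0] = ord_max |: upto M.+2 M.
Proof.
apply/setP => i; rewrite !inE -!val_eqE /=; have := ltn_ord i; lia.
Qed.

Lemma card_upto M : #|upto M.+2 M| = M.
Proof.
have := cardsC1 (@ord0 M.+1); rewrite upto_C0 cardsU1 card_ord inE /= ltnn /=.
by rewrite add1n => -[].
Qed.

(** Here [k] counts the vertices of the right subtree other than [ord_max]; the right subtree has
    [k.+1] vertices and the left one [M - k]. *)
Lemma andre_sum_rec M : andre_sum M.+2 = \sum_(k < M.+1)
  y ^+ (M - k == 0)%N * q ^+ (M - k) * (andre_sum k.+1 * andre_sum (M - k)) * gauss q M k.
Proof.
rewrite {1}/andre_sum.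
rewrite (partition_big (fun f => [set w | in_subtree f true ord0 w])
  (fun A => ord0 \notin A)) /=; last first.
  by move=> f /andP[inc_f _]; rewrite inE in_subtree_ord0.
under eq_bigr => A A0 do rewrite sum_right_subtree //.
rewrite (eq_bigl (fun A : {set 'I_M.+2} => A \subset ord_max |: upto M.+2 M)); last first.
  by move=> A; rewrite -upto_C0 subsetC sub1set inE.
have max_notin : ord_max \notin upto M.+2 M by rewrite inE /= ltnn.
(* Right vertex sets without [ord_max] contribute 0, so only the sets [ord_max |: A] remain. *)
rewrite sum_subset_setU1 //.
have cardle (A : {set 'I_M.+2}) : A \subset upto M.+2 M -> (#|A| < M.+1)%N.
  by move/subset_leq_card; rewrite card_upto ltnS.
rewrite (partition_big (fun A : {set 'I_M.+2} => inord #|A| : 'I_M.+1) predT) //=.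
apply: eq_bigr => k _.
rewrite -(@crossing_gauss M.+2) // mulr_sumr.
apply: eq_big => [A|A /andP[sA /eqP defk]].
  by case sA: (A \subset _) => //=; rewrite -val_eqE /= inordK ?cardle.
have {}defk : #|A| = k by rewrite -defk inordK ?cardle.
have maxA : ord_max \notin A by apply: contra max_notin => /(subsetP sA).
have A0 : ord0 \notin ord_max |: A.
  by rewrite !inE /=; apply/negP => /(subsetP sA); rewrite inE.
(* The label [ord_max] on the right is below no left vertex, so crossings are counted within
   [upto M.+2 M]. *)
rewrite (negPf maxA) setU11 add0r upto_C0 crossing_topU; last first.
  by move=> j; rewrite inE /= => /andP[].
have -> : #|side (ord_max |: A) false| = (M - k)%N.
  have cU : #|ord0 |: (ord_max |: A)| = k.+2 by rewrite !cardsU1 A0 maxA defk.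
  by rewrite /side cardsCs setCK cU card_ord.
rewrite cardsU1 maxA defk exprD add1n.
by move: (nat_of_bool _) (andre_sum _) (andre_sum _) (crossing _ _) => e a b c; ring.
Qed.

End Recurrence.

(** If [qpoch q n.-1] vanished, the quotient [qbinom q n.-1 0] would be 0/0, which evaluates to 0
    instead of 1. *)
Theorem theorem6p8 (R : fieldType) (q x y : R) (n : nat) :
  (1 <= n)%N -> qpoch q n.-1 != 0 ->
  EI q x y n.+1 =
    y * EI q x y n +
    \sum_(0 <= k < n.-1)
       q ^+ (n - k - 1) * qbinom q n.-1 k * EI q x y k.+1 * EI q x y (n - k - 1).
Proof.
case: n => // M _; rewrite -[M.+1.-1]/M => qM.
rewrite !(@andre_sum_EI _ q x y _.+1) // andre_sum_rec big_ord_recr /=.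
(* The last term, [k = M], is the case of an empty left subtree, of weight [andre_sum 0 = 1]; it
   gives the [y] term. For [k < M] the index [M - k] is positive, so [EI] and [andre_sum] agree. *)
rewrite addrC subnn eqxx expr1 expr0 gaussnn andre_sum0 !mulr1 big_mkord.
congr (_ + _); apply: eq_bigr => k _; have lt_kM := ltn_ord k.
have -> : (M.+1 - k - 1 = M - k)%N by lia.
have Mk0 : (0 < M - k)%N by rewrite subn_gt0.
by rewrite qbinom_gauss ?(ltnW lt_kM) // (andre_sum_EI _ _ _ Mk0)
  gtn_eqF //= expr0 mul1r mulrAC !mulrA.
Qed.
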